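(* Let $A\in M_2$ have distinct eigenvalues $\lambda_1\neq\lambda_2$ with corresponding eigenvectors $a_1,a_2\in\mathbb{C}^2$, and let $B\in M_2$ have distinct eigenvalues $\mu_1\neq\mu_2$ with corresponding eigenvectors $v_1a_1+a_2$ and $v_2a_1+a_2$, where $v_1,v_2\in\mathbb{C}$ (so $v_1\ne v_2$). Put $\lambda=\lambda_1-\lambda_2$ and $\mu=\mu_1-\mu_2$. Let $p$ be the bijection $\lambda_1\mapsto\mu_1,\ \lambda_2\mapsto\mu_2$ and $q$ the bijection $\lambda_1\mapsto\mu_2,\ \lambda_2\mapsto\mu_1$. Taking arguments in $(-\pi,\pi]$, let $\theta'\le\theta$ be the arguments of the two nonzero complex numbers $$\left(\frac{\alpha-1}{\alpha}\right)\left(\frac{v_1+v_2\pm2\sqrt{v_1v_2}}{v_1-v_2}\right),\qquad \alpha\in(0,1),$$ which do not depend on $\alpha$. Then: (a) If $|\arg(\mu/\lambda)|=\theta$, then both $p$ and $q$ are convex eigenpairings of $A$ and $B$. (b) If $|\arg(\mu/\lambda)|<\theta$, then only $p$ is a convex eigenpairing of $A$ and $B$. (c) If $|\arg(\mu/\lambda)|>\theta$, then only $q$ is a convex eigenpairing of $A$ and $B$.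
   Context: $M_2$ is the space of $2\times2$ complex matrices. Given $A,B\in M_2$ let $C_\alpha=(1-\alpha)A+\alpha B$ for $\alpha\in[0,1]$. A convex eigenpath set is a multiset $\{\gamma_1,\gamma_2\}$ of continuous functions $[0,1]\to\mathbb{C}$ such that for all $\alpha\in[0,1]$ the multiset of eigenvalues of $C_\alpha$ (with algebraic multiplicity) equals $\{\gamma_1(\alpha),\gamma_2(\alpha)\}$. A convex eigenpairing of $A$ and $B$ is a bijection from the eigenvalues of $A$ to the eigenvalues of $B$ given by $\gamma_j(0)\mapsto\gamma_j(1)$, $j=1,2$, for some convex eigenpath set. $\sqrt{v_1v_2}$ denotes either square root; the unordered pair of numbers with signs $\pm$ does not depend on the choice. *)

(* Defs.v *)
From HB Require Import structures.
From mathcomp Require Import all_boot all_order all_algebra.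
From mathcomp Require Import all_classical all_reals all_analysis.
From mathcomp Require Import complex.

Set Implicit Arguments.
Unset Strict Implicit.
Unset Printing Implicit Defensive.

Import Order.TTheory GRing.Theory Num.Theory.
Import numFieldNormedType.Exports.

Local Open Scope classical_set_scope.
Local Open Scope ring_scope.
Local Open Scope complex_scope.

(* The principal argument, in ]-pi, pi]; characterized by ArgP and Arg_unique
   when z != 0, and meaningless at z = 0. *)
Definition Arg (R : realType) (z : R[i]) : R :=
  xget 0 [set t | - pi < t <= pi /\ z = `|z| * (cos t +i* sin t)].

Definition is_eigenvector (R : realType) (n : nat) (A : 'M[R[i]]_n)
    (l : R[i]) (v : 'cV[R[i]]_n) : Prop :=
  v != 0 /\ A *m v = l *: v.

Definition convex_comb (R : realType) (n : nat) (A B : 'M[R[i]]_n)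
    (alpha : R) : 'M[R[i]]_n :=
  (1 - alpha)%:C *: A + alpha%:C *: B.

Definition alg_mult (R : realType) (n : nat) (A : 'M[R[i]]_n) (z : R[i]) : nat :=
  mup z (char_poly A).

(* The multiset {g1, g2} is given by an ordered pair of functions, in which the
   definition is symmetric. Two multisets of numbers are equal when every z has
   the same multiplicity in both. R[i]^o is R[i] with the topology of its
   modulus; only the values of g1 and g2 on [0, 1] matter. *)
Definition convex_eigenpath_set (R : realType) (A B : 'M[R[i]]_2)
    (g1 g2 : R -> R[i]^o) : Prop :=
  [/\ {within `[0, 1], continuous g1},
      {within `[0, 1], continuous g2} &
      forall alpha : R, 0 <= alpha <= 1 -> forall z : R[i],
        alg_mult (convex_comb A B alpha) z =
        count_mem z [:: g1 alpha : R[i]; g2 alpha : R[i]]].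

(* A bijection between the spectra is represented by a function on R[i] whose
   values outside the spectrum of A are irrelevant. *)
Definition convex_eigenpairing (R : realType) (A B : 'M[R[i]]_2)
    (f : R[i] -> R[i]) : Prop :=
  set_bij [set z | eigenvalue A z] [set z | eigenvalue B z] f /\
  exists g1 g2 : R -> R[i]^o, [/\ convex_eigenpath_set A B g1 g2,
    f (g1 0) = g1 1 & f (g2 0) = g2 1].

Definition only_convex_eigenpairing (R : realType) (A B : 'M[R[i]]_2)
    (f : R[i] -> R[i]) : Prop :=
  convex_eigenpairing A B f /\
  forall h : R[i] -> R[i],
    convex_eigenpairing A B h -> {in eigenvalue A, h =1 f}.

(* With s a square root of v1 * v2, the two numbers whose arguments give the
   threshold are those for s and - s. *)
Definition threshold_number (R : realType) (v1 v2 s : R[i]) (alpha : R) : R[i] :=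
  ((alpha - 1) / alpha)%:C * ((v1 + v2 + 2 * s) / (v1 - v2)).

Definition threshold (R : realType) (v1 v2 s : R[i]) (alpha : R) : R :=
  Num.max (Arg (threshold_number v1 v2 s alpha))
          (Arg (threshold_number v1 v2 (- s) alpha)).

Lemma ArgP (R : realType) (z : R[i]) : z != 0 ->
  - pi < Arg z <= pi /\ z = `|z| * (cos (Arg z) +i* sin (Arg z)).
Proof.
move=> z0.
suff [t Pt] : exists t : R, - pi < t <= pi /\ z = `|z| * (cos t +i* sin t).
  exact: (@xgetPex _ 0 [set t | - pi < t <= pi /\ z = `|z| * (cos t +i* sin t)]
            (ex_intro _ t Pt)).
case: z z0 => a b z0.
set r := Num.sqrt (a ^+ 2 + b ^+ 2).
have r2 : r ^+ 2 = a ^+ 2 + b ^+ 2 by rewrite sqr_sqrtr // addr_ge0 ?sqr_ge0.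
have nE : `|a +i* b| = r%:C by [].
have rn0 : r != 0.
  by apply: contra z0 => /eqP r0; rewrite -normr_eq0 nE r0.
have rp : 0 < r by rewrite lt_neqAle eq_sym rn0 sqrtr_ge0.
have ab1 : (a / r) ^+ 2 + (b / r) ^+ 2 = 1.
  by rewrite !expr_div_n -mulrDl -r2 divff // expf_neq0.
have /andP[c1 c2] : -1 <= a / r <= 1.
  rewrite -ler_norml -(@ler_pXn2r _ 2) ?nnegrE // expr1n real_normK ?num_real //.
  by rewrite -ab1 lerDl sqr_ge0.
have sE : Num.sqrt (1 - (a / r) ^+ 2) = `|b / r|.
  by rewrite -ab1 addrC addKr sqrtr_sqr.
have rcos : r * cos (acos (a / r)) = a.
  by rewrite acosK ?in_itv /= ?c1 // mulrC divfK.
have rsin : r * sin (acos (a / r)) = `|b|.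
  by rewrite sin_acos ?c1 // sE normrM normfV (gtr0_norm rp) mulrC divfK.
have a0 : 0 <= acos (a / r) by rewrite acos_ge0 ?c1.
have api : acos (a / r) <= pi by rewrite acos_lepi ?c1.
have mulE t : r%:C * (cos t +i* sin t) = (r * cos t) +i* (r * sin t).
  by rewrite /GRing.mul /= !mul0r subr0 addr0.
have [b0|b0] := leP 0 b.
  exists (acos (a / r)); rewrite api (lt_le_trans _ a0) ?oppr_lt0 ?pi_gt0 //.
  by split=> //; rewrite nE mulE rcos rsin ger0_norm.
exists (- acos (a / r)); rewrite nE mulE cosN sinN mulrN rcos rsin.
rewrite ltr0_norm // opprK; split=> //.
rewrite ltrN2 (le_trans _ (pi_ge0 R)) ?oppr_le0 // andbT.
rewrite lt_neqAle api andbT; apply/eqP => apiE.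
by move: rsin; rewrite apiE sinpi mulr0 => /eqP; rewrite eq_sym normr_eq0 lt_eqF.
Qed.

Lemma Arg_unique (R : realType) (z : R[i]) (t : R) : z != 0 ->
  - pi < t <= pi -> z = `|z| * (cos t +i* sin t) -> Arg z = t.
Proof.
move=> z0 tI zt; have [uI zu] := ArgP z0.
have n0 : `|z| != 0 by rewrite normr_eq0.
have : cos (Arg z) +i* sin (Arg z) = cos t +i* sin t.
  by apply: (mulfI n0); rewrite -zu -zt.
case=> ceq seq; have d1 : cos (Arg z - t) = 1.
  by rewrite cosB ceq seq -!expr2 cos2Dsin2.
have cinj x y : 0 <= x <= pi -> 0 <= y <= pi -> cos x = cos y -> x = y :> R.
  move=> xI yI; apply: cos_inj; rewrite in_itv //=.
have sneg x : - pi < x < 0 -> sin x < 0 :> R.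
  move=> /andP[x1 x2]; rewrite -[x]opprK sinN oppr_lt0 sin_gt0_pi //.
  by rewrite oppr_gt0 x2 /= ltrNl.
have spos x : 0 <= x <= pi -> 0 <= sin x :> R by move=> xI; exact: sin_ge0_pi.
case/andP: uI => u1 u2; case/andP: tI => t1 t2.
have [u0|u0] := leP 0 (Arg z); have [t0|t0] := leP 0 t.
- by apply: cinj; rewrite ?u0 ?t0.
- have := sneg t; rewrite t1 t0 -seq => /(_ isT).
  by rewrite ltNge spos ?u0.
- have := sneg (Arg z); rewrite u1 u0 seq => /(_ isT).
  by rewrite ltNge spos ?t0.
- apply: oppr_inj; apply: cinj; rewrite ?cosN //.
  + by rewrite oppr_ge0 (ltW u0) lerNl ltW.
  + by rewrite oppr_ge0 (ltW t0) lerNl ltW.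
Qed.

(* Main.v *)
(* In the basis (a1, a2), writing lambda = lambda1 - lambda2, mu = mu1 - mu2,
   rho = mu / lambda and c = (v1 + v2 + 2 s) / (v1 - v2), whose inverse is
   (v1 + v2 - 2 s) / (v1 - v2), the discriminant of the characteristic polynomial
   of C_t is lambda^2 (1 - t + t rho c) (1 - t + t rho / c). Along each of the two
   segments there is a continuous square root starting at 1 and staying in the
   closed right half-plane, so the eigenvalues are
   (tr C_t +- lambda g_1(t) g_2(t)) / 2, and the pairing is p or q according to
   whether g_1(1) g_2(1), a square root of rho^2, is rho or - rho. Take square
   roots w1, w2 of rho c, rho / c with w1 w2 = rho: then Re w1 Re w2 is a positive
   multiple of cos (Arg rho) + cos (Arg c), whose sign compares |Arg rho| with
   pi - |Arg c| = theta. When it is nonzero the two eigenvalues stay distinct on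
   [0, 1], and the eigenpath set is unique. *)

Require Import Defs.
From HB Require Import structures.
From mathcomp Require Import all_boot all_order all_algebra.
From mathcomp Require Import all_classical all_reals all_analysis.
From mathcomp Require Import complex ring lra.

Set Implicit Arguments.
Unset Strict Implicit.
Unset Printing Implicit Defensive.

Import Order.TTheory GRing.Theory Num.Theory.
Import numFieldNormedType.Exports.

Local Open Scope classical_set_scope.
Local Open Scope ring_scope.
Local Open Scope complex_scope.

(* [Re] alone would be the projection with values in R[i]. *)
Local Notation Re := (@complex.Re _).

(** * Continuity of complex paths, and a continuous square root along a segment *)

Lemma normc_le_ReIm (R : realType) (x y : R) : `|x +i* y| <= (`|x| + `|y|)%:C.
Proof.
rewrite normc_def lecR /= -[leRHS]ger0_norm ?addr_ge0 // -sqrtr_sqr ler_wsqrtr //.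
by rewrite sqrrD !real_normK ?num_real // -addrA lerD2l lerDr mulrn_wge0 ?mulr_ge0.
Qed.

Lemma continuous_complex (R : realType) (f g : R -> R) :
  continuous f -> continuous g ->
  continuous (fun t => (f t +i* g t : R[i]^o)).
Proof.
move=> fc gc x; apply/cvgrPdist_lt => -[e e'].
(* The radius lives in [R[i]], where being positive includes being real. *)
rewrite ltcE /= => /andP[/eqP -> e0]; have e20 : 0 < e / 2 by lra.
have /cvgrPdist_lt/(_ _ e20) fx := fc x.
have /cvgrPdist_lt/(_ _ e20) gx := gc x.
near=> t; apply: le_lt_trans (normc_le_ReIm _ _) _.
rewrite ltcR [ltRHS]splitr ltrD //; near: t; [exact: fx | exact: gx].
Unshelve. all: by end_near. Qed.

Lemma continuous_Re (R : realType) : continuous (Re : R[i]^o -> R).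
Proof.
move=> z; apply/(@cvgrPdist_lt _ _ R[i]^o (nbhs z)) => e e0.
have e0' : 0 < e%:C :> R[i] by rewrite ltcR.
near=> w.
have : `|z - w| < e%:C by near: w; exact: (@nbhsx_ballx _ R[i]^o z _ e0').
rewrite -ltcR; apply: le_lt_trans.
by rewrite -raddfB; exact: normc_ge_Re.
Unshelve. all: by end_near. Qed.

(* The imaginary part keeps a constant sign along a segment starting at 1, so
   the half-angle formulas for the real and imaginary parts of the square root
   give a continuous path even when the segment meets the branch cut. *)
Lemma segment_sqrt_path (R : realType) (w : R[i]) : 0 <= Re w ->
  exists g : R -> R[i]^o, [/\ continuous g, g 0 = 1, g 1 = w,
    forall t, 0 <= t -> g t ^+ 2 = (1 - t)%:C + t%:C * w ^+ 2 &
    0 < Re w -> forall t, 0 <= t <= 1 -> g t != 0].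
Proof.
case: w => x y /= x0.
(* [p t +i* q t] is the point of the segment from 1 to [(x +i* y) ^+ 2] at time [t], and [N t] is
   its modulus. *)
pose p t := 1 - t + t * (x ^+ 2 - y ^+ 2) : R.
pose q t := t * (2 * x * y) : R.
pose N t := Num.sqrt (p t ^+ 2 + q t ^+ 2).
pose e : R := if y < 0 then -1 else 1.
have ee : e * e = 1 by rewrite /e; case: ifP => _; ring.
have ey : e * `|y| = y.
  by rewrite /e; case: ltrP => y0; [rewrite ltr0_norm | rewrite ger0_norm];
    rewrite ?mulN1r ?mul1r ?opprK.
have NE t : N t ^+ 2 = p t ^+ 2 + q t ^+ 2.
  by rewrite sqr_sqrtr // addr_ge0 ?sqr_ge0.
have pN t : `|p t| <= N t.
  by rewrite -sqrtr_sqr ler_wsqrtr // lerDl sqr_ge0.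
have Np t : 0 <= (N t + p t) / 2 by have := pN t; rewrite ler_norml; lra.
have Nm t : 0 <= (N t - p t) / 2 by have := pN t; rewrite ler_norml; lra.
pose g t := (Num.sqrt ((N t + p t) / 2) +i* (e * Num.sqrt ((N t - p t) / 2))).
have lin t : (1 - t)%:C + t%:C * (x +i* y) ^+ 2 = p t +i* q t.
  apply/eqP; rewrite eq_complex /=; apply/andP.
  by split; apply/eqP; rewrite /p /q; ring.
have gE t : 0 <= t -> g t ^+ 2 = (1 - t)%:C + t%:C * (x +i* y) ^+ 2.
  move=> t0; rewrite lin.
  have sq a b : (a +i* b) ^+ 2 = (a ^+ 2 - b ^+ 2) +i* (2 * (a * b)) :> R[i].
    by apply/eqP; rewrite eq_complex /=; apply/andP; split; apply/eqP; ring.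
  have e2 : e ^+ 2 = 1 by rewrite expr2.
  rewrite sq; congr (_ +i* _); first by rewrite exprMn e2 !sqr_sqrtr //; field.
  have -> : q t = e * `|q t|.
    by rewrite /q !normrM (ger0_norm t0) (ger0_norm x0) ger0_norm // -{1}ey; ring.
  rewrite [X in 2 * X]mulrCA -sqrtrM // [LHS]mulrCA; congr (_ * _).
  have -> : (N t + p t) / 2 * ((N t - p t) / 2) = (q t / 2) ^+ 2.
    by rewrite mulrACA [_ * (_ - _)]mulrC -subr_sqr NE; field.
  rewrite sqrtr_sqr normrM [`|2^-1|]gtr0_norm ?invr_gt0 // mulrCA.
  by rewrite divff ?mulr1 // pnatr_eq0.
have pc : continuous p.
  move=> t; apply: cvgD; first by apply: cvgB; [exact: cvg_cst | exact: cvg_id].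
  by apply: cvgM; [exact: cvg_id | exact: cvg_cst].
have qc : continuous q.
  by move=> t; apply: cvgM; [exact: cvg_id | exact: cvg_cst].
have Nc : continuous N.
  move=> t; apply: (continuous_comp (f := fun t => p t ^+ 2 + q t ^+ 2)).
    2: exact: sqrt_continuous.
  by apply: cvgD; under eq_fun do rewrite expr2;
    apply: cvgM; (exact: pc || exact: qc).
exists g; split => //.
- apply: continuous_complex => t.
    apply: (continuous_comp (f := fun t => (N t + p t) / 2));
      last exact: sqrt_continuous.
    by apply: cvgM; [apply: cvgD; [exact: Nc | exact: pc] | exact: cvg_cst].
  apply: cvgM; first exact: cvg_cst.
  apply: (continuous_comp (f := fun t => (N t - p t) / 2));
    last exact: sqrt_continuous.
  by apply: cvgM; [apply: cvgB; [exact: Nc | exact: pc] | exact: cvg_cst].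
- rewrite /g /N /p /q !mul0r subr0 addr0 expr0n expr1n addr0 sqrtr1 subrr mul0r.
  by rewrite sqrtr0 mulr0 -[1 + 1]/(2%:R) divff ?pnatr_eq0 // sqrtr1.
- have N1 : N 1 = x ^+ 2 + y ^+ 2.
    rewrite -[RHS]ger0_norm ?addr_ge0 ?sqr_ge0 // -sqrtr_sqr /N /p /q.
    by congr Num.sqrt; ring.
  rewrite /g N1 /p.
  have -> : (x ^+ 2 + y ^+ 2 + (1 - 1 + 1 * (x ^+ 2 - y ^+ 2))) / 2 = x ^+ 2.
    by field.
  have -> : (x ^+ 2 + y ^+ 2 - (1 - 1 + 1 * (x ^+ 2 - y ^+ 2))) / 2 = y ^+ 2.
    by field.
  by rewrite !sqrtr_sqr ey ger0_norm.
(* A zero of [g] forces [p t = q t = 0]. With [x > 0] this gives [t = 0], where [p] is 1, or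
   [y = 0], where [p t = 1 - t + t * x ^+ 2] is positive on [0, 1]. *)
- move=> xp t /andP[t0 t1]; apply/negP => /eqP gt0.
  have := gE t t0; rewrite gt0 expr0n lin /= => -[/esym pt /esym qt].
  move: pt qt; rewrite /p /q => pt qt.
  have : t * (x * y) = 0 by lra.
  move=> /eqP; rewrite !mulf_eq0 (gt_eqF xp) /= => /orP[] /eqP z0.
    by move: pt; rewrite z0; lra.
    have x2 : 0 < x ^+ 2 by rewrite exprn_gt0.
    move: pt; rewrite z0 expr0n subr0 => pt.
    have tx : 0 <= t * x ^+ 2 by rewrite mulr_ge0 // ltW.
    have t1' : t = 1 by lra.
    by move: pt; rewrite t1'; lra.
Qed.

(** * Eigenvalue multisets, and the pairings induced by continuous eigenvalue paths *)

Lemma alg_mult_XsubC2 (R : realType) n (M : 'M[R[i]]_n) (x y z : R[i]) :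
  char_poly M = ('X - x%:P) * ('X - y%:P) ->
  alg_mult M z = count_mem z [:: x; y].
Proof.
move=> ME; rewrite /alg_mult ME mupM ?polyXsubC_eq0 //.
by rewrite -['X - x%:P]expr1 -['X - y%:P]expr1 !mup_XsubCX /= addn0; do 2 case: eqP.
Qed.

Lemma perm_eq2P (T : eqType) (x y x' y' : T) : perm_eq [:: x; y] [:: x'; y'] ->
  x = x' /\ y = y' \/ x = y' /\ y = x'.
Proof.
move=> P; have := perm_mem P x; rewrite inE eqxx !inE => /esym/orP[]/eqP E.
  by left; split=> //; move: P; rewrite E perm_cons => /perm_small_eq => /(_ isT)[].
right; split=> //; have := perm_trans P (permEl (perm_catC [:: x'] [:: y'])).
by rewrite E perm_cons => /perm_small_eq => /(_ isT)[].
Qed.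

Lemma eigenvalue_XsubC2 (F : fieldType) n (M : 'M[F]_n) (x y z : F) :
  char_poly M = ('X - x%:P) * ('X - y%:P) ->
  eigenvalue M z = (z == x) || (z == y).
Proof. by move=> ME; rewrite eigenvalue_root_char ME rootM !root_XsubC. Qed.

Lemma convex_comb0 (R : realType) n (A B : 'M[R[i]]_n) : convex_comb A B 0 = A.
Proof. by rewrite /convex_comb subr0 scale1r scale0r addr0. Qed.

Lemma convex_comb1 (R : realType) n (A B : 'M[R[i]]_n) : convex_comb A B 1 = B.
Proof. by rewrite /convex_comb subrr scale1r scale0r add0r. Qed.

Section Pairing.
Variables (R : realType) (A B : 'M[R[i]]_2) (e1 e2 : R -> R[i]^o).
Variable f : R[i] -> R[i].
Hypotheses (e1c : continuous e1) (e2c : continuous e2).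
Hypothesis charE : forall t, 0 <= t <= 1 ->
  char_poly (convex_comb A B t) = ('X - (e1 t : R[i])%:P) * ('X - (e2 t : R[i])%:P).
Hypotheses (e0 : e1 0 != e2 0) (e1' : e1 1 != e2 1).
Hypotheses (f1 : f (e1 0) = e1 1) (f2 : f (e2 0) = e2 1).

Let eigA z : eigenvalue A z = (z == e1 0) || (z == e2 0).
Proof.
have I : 0 <= (0 : R) <= 1 by rewrite lexx ler01.
by have := eigenvalue_XsubC2 z (charE I); rewrite convex_comb0.
Qed.

Let eigB z : eigenvalue B z = (z == e1 1) || (z == e2 1).
Proof.
have I : 0 <= (1 : R) <= 1 by rewrite lexx ler01.
by have := eigenvalue_XsubC2 z (charE I); rewrite convex_comb1.
Qed.

(** The factorizations at 0 and 1 identify the spectra of [A] and [B] with the endpoints of the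
    paths, and distinct endpoints make [f] bijective between them. *)
Lemma convex_eigenpairing_of_paths : convex_eigenpairing A B f.
Proof.
split.
  split=> [z|z z'|z] /=.
  - by rewrite eigA eigB => /orP[]/eqP->; rewrite ?f1 ?f2 eqxx ?orbT.
  - move=> /set_mem/=; rewrite eigA => zA /set_mem/=; rewrite eigA => zA'.
    case/orP: zA zA' => /eqP-> /orP[]/eqP-> //; rewrite f1 f2 => E.
      by move: e1'; rewrite E eqxx.
    by move: e1'; rewrite E eqxx.
  - rewrite eigB => /orP[]/eqP->; [exists (e1 0)|exists (e2 0)] => //.
      by rewrite eigA eqxx.
    by rewrite eigA eqxx orbT.
exists e1, e2; split; [split | exact: f1 | exact: f2].
- exact: (continuous_subspaceT e1c).
- exact: (continuous_subspaceT e2c).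
- by move=> t tI z; exact: alg_mult_XsubC2 (charE tI).
Qed.

Hypothesis e12 : forall t, 0 <= t <= 1 -> e1 t != e2 t.

(* The quotient of the two differences of paths takes the values 1 and -1 only,
   hence is constant. *)
Lemma only_convex_eigenpairing_of_paths : only_convex_eigenpairing A B f.
Proof.
split; first exact: convex_eigenpairing_of_paths.
move=> h [_ [g1 [g2 [[g1c g2c gE] h1 h2]]]].
have gP t : 0 <= t <= 1 ->
    g1 t = e1 t /\ g2 t = e2 t \/ g1 t = e2 t /\ g2 t = e1 t.
  (* [perm_eq] unfolds to equality of counts, which is how multiplicities are stated in [gE]. *)
  move=> tI; apply: perm_eq2P; rewrite -[perm_eq _ _]/(all _ _).
  apply/allP => z _; apply/eqP; apply: etrans (esym (gE _ tI z)) _.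
  by exact: alg_mult_XsubC2 (charE tI).
(* The quotient is 1 or -1, so taking its real part loses nothing and makes the intermediate value
   theorem available. *)
pose r t := Re ((g1 t - g2 t) / (e1 t - e2 t)).
have rP t : 0 <= t <= 1 -> g1 t = e1 t /\ g2 t = e2 t /\ r t = 1 \/
    g1 t = e2 t /\ g2 t = e1 t /\ r t = -1.
  move=> tI; have n0 : e1 t - e2 t != 0 by rewrite subr_eq0 e12.
  rewrite /r; case: (gP t tI) => -[-> ->]; [left|right]; do 2 split => //.
    by rewrite divff.
  by rewrite -opprB mulNr divff.
have rc : {within `[0, 1], continuous r}.
  apply/subspace_continuousP => t /=; rewrite in_itv /= => tI.
  have /subspace_continuousP/(_ t) c1 := g1c.
  have /subspace_continuousP/(_ t) c2 := g2c.
  apply: (@cvg_comp _ _ _ (fun t => (g1 t - g2 t) / (e1 t - e2 t) : R[i]^o) Re);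
    last exact: continuous_Re.
  apply: cvgM; first by apply: cvgB; [apply: c1|apply: c2]; rewrite /= in_itv.
  apply: cvgV; first by rewrite subr_eq0 e12.
  by apply: cvg_within_filter; apply: cvgB; [exact: e1c|exact: e2c].
have r01 : r 0 = r 1.
  have i0 : 0 <= (0 : R) <= 1 by rewrite lexx ler01.
  have i1 : 0 <= (1 : R) <= 1 by rewrite lexx ler01.
  have noz : Num.min (r 0) (r 1) <= 0 <= Num.max (r 0) (r 1) -> False.
    move=> /(IVT ler01 rc)[t]; rewrite in_itv /= => /rP.
    by case=> -[_ [_ ->]] /eqP; rewrite ?oppr_eq0 oner_eq0.
  case: (rP _ i0) (rP _ i1) => -[_ [_ r0]] [] -[_ [_ r1]]; rewrite r0 r1 // in noz *.
    by case: noz; rewrite /Num.min /Num.max; case: ltP; lra.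
  by case: noz; rewrite /Num.min /Num.max; case: ltP; lra.
have i0 : 0 <= (0 : R) <= 1 by rewrite lexx ler01.
have i1 : 0 <= (1 : R) <= 1 by rewrite lexx ler01.
move=> z zE; have {}zE : (z == e1 0) || (z == e2 0) by rewrite -eigA.
have n1 : 1 <> -1 :> R by lra.
move: h1 h2.
(* By [r01], [g1] and [g2] follow [e1] and [e2] in the same order at both ends; swapping the two
   paths only exchanges [h1] and [h2]. *)
case: (rP _ i0) => -[-> [-> r0]]; case: (rP _ i1) => -[-> [-> r1]];
  (try by case: n1; move: r01; rewrite r0 r1) => h1 h2;
  by case/orP: zE => /eqP->; rewrite ?f1 ?f2.
Qed.
End Pairing.

(** * Characteristic polynomial of the pencil in the basis of eigenvectors of [A] *)

Lemma det2E (K : comNzRingType) (M : 'M[K]_2) :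
  \det M = M 0 0 * M 1 1 - M 0 1 * M 1 0.
Proof.
rewrite (expand_det_row _ 0) !big_ord_recl big_ord0 addr0 /cofactor !det_mx11 !mxE /=.
have l0 : lift 0 0 = 1 :> 'I_2 by apply: val_inj.
have l1 : lift 1 0 = 0 :> 'I_2 by apply: val_inj.
by rewrite !l0 l1 /= add0n expr0 expr1 mul1r mulN1r mulrN.
Qed.

(** With [P] the matrix of columns [a1], [a2] and [N] the matrix of [M] in that basis, [M P = P N],
    so both have the same characteristic polynomial. That of [N] depends only on its trace and
    determinant. *)
Lemma char_poly_basis2 (K : fieldType) (M : 'M[K]_2) (a1 a2 : 'cV[K]_2)
    (m11 m12 m21 m22 e1 e2 : K) :
  \det (row_mx a1 a2 : 'M[K]_2) != 0 ->
  M *m a1 = m11 *: a1 + m21 *: a2 -> M *m a2 = m12 *: a1 + m22 *: a2 ->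
  e1 + e2 = m11 + m22 -> e1 * e2 = m11 * m22 - m12 * m21 ->
  char_poly M = ('X - e1%:P) * ('X - e2%:P).
Proof.
move=> P0 M1 M2 eS eM; set P : 'M[K]_2 := row_mx a1 a2 in P0.
pose N : 'M[K]_(1 + 1) := block_mx m11%:M m12%:M m21%:M m22%:M.
have MP : M *m P = P *m (N : 'M[K]_2).
  have E := mul_row_block a1 a2 m11%:M m12%:M m21%:M m22%:M.
  rewrite !mul_mx_scalar -M1 -M2 in E.
  exact: etrans (mul_mx_row M a1 a2) (esym E).
pose PX : 'M[{poly K}]_2 := map_mx (@polyC K) P.
have : \det (char_poly_mx M *m PX) = \det (PX *m char_poly_mx (N : 'M[K]_2)).
  rewrite /char_poly_mx mulmxBl mulmxBr /PX -!map_mxM MP.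
  by rewrite mul_scalar_mx mul_mx_scalar.
have PX0 : \det PX != 0 by rewrite det_map_mx polyC_eq0.
rewrite /char_poly !det_mulmx [RHS]mulrC => /(mulIf PX0) ->.
have [N00 N01 N10 N11] :
    [/\ (N : 'M[K]_2) 0 0 = m11, (N : 'M[K]_2) 0 1 = m12,
        (N : 'M[K]_2) 1 0 = m21 & (N : 'M[K]_2) 1 1 = m22].
  have i0 : 0 = lshift 1 0 :> 'I_(1 + 1) by apply: val_inj.
  have i1 : 1 = rshift 1 0 :> 'I_(1 + 1) by apply: val_inj.
  rewrite i0 i1; split; [apply: etrans (block_mxEul _ _ _ _ _ _) _
    | apply: etrans (block_mxEur _ _ _ _ _ _) _
    | apply: etrans (block_mxEdl _ _ _ _ _ _) _
    | apply: etrans (block_mxEdr _ _ _ _ _ _) _]; by rewrite mxE eqxx.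
have cE (Q : 'M[K]_2) i j : char_poly_mx Q i j = 'X *+ (i == j) - (Q i j)%:P.
  by rewrite !mxE.
rewrite det2E !cE N00 N01 N10 N11 /= mulr1n mulr0n !sub0r mulrNN.
transitivity ('X ^+ 2 - (m11 + m22)%:P * 'X + (m11 * m22 - m12 * m21)%:P).
  by rewrite !(polyCD, polyCM, polyCN); ring.
by rewrite -eS -eM !(polyCD, polyCM); ring.
Qed.

Lemma eigenvectors_det2 (K : fieldType) (M : 'M[K]_2) (a1 a2 : 'cV[K]_2) (l1 l2 : K) :
  l1 != l2 -> a1 != 0 -> a2 != 0 -> M *m a1 = l1 *: a1 -> M *m a2 = l2 *: a2 ->
  \det (row_mx a1 a2 : 'M[K]_2) != 0.
Proof.
move=> l12 a10 a20 M1 M2; rewrite -det_tr; apply/det0P => -[v v0].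
set x := v 0 0; set y := v 0 1.
move=> /rowP v_ker; have E : x *: a1 + y *: a2 = 0.
  apply/colP => i; have := v_ker i; rewrite !mxE !big_ord_recl big_ord0 addr0.
  have -> : lift 0 0 = 1 :> 'I_2 by apply: val_inj.
  rewrite ![_^T _ _]mxE.
  have -> : (row_mx a1 a2 : 'M[K]_2) i 0 = a1 i 0.
    by rewrite -(row_mxEl a1 a2 i 0); congr fun_of_matrix; apply: val_inj.
  have -> // : (row_mx a1 a2 : 'M[K]_2) i 1 = a2 i 0.
  by rewrite -(row_mxEr a1 a2 i 0); congr fun_of_matrix; apply: val_inj.
have E2 := congr1 (mulmx M) E; move: E2.
rewrite mulmxDr -!scalemxAr M1 M2 mulmx0 => E2.
(* Subtracting [l1] times the relation from its image under [M] eliminates [a1]. *)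
have y0 : y = 0.
  have : (y * (l2 - l1)) *: a2 = 0.
    transitivity (x *: (l1 *: a1) + y *: (l2 *: a2) - l1 *: (x *: a1 + y *: a2)).
      rewrite scalerDr !scalerA opprD addrACA [l1 * x]mulrC subrr add0r.
      by rewrite -scalerBl; congr (_ *: _); ring.
    by rewrite E E2 scaler0 subr0.
  move/eqP; rewrite scaler_eq0 (negPf a20) orbF mulf_eq0 subr_eq0 [l2 == _]eq_sym.
  by rewrite (negPf l12) orbF => /eqP.
have x0 : x = 0.
  move: E; rewrite y0 scale0r addr0 => /eqP.
  by rewrite scaler_eq0 (negPf a10) orbF => /eqP.
move/eqP: v0; apply; apply/rowP => i; rewrite mxE.
case: i => [[|[|//]] ?]; [rewrite -[RHS]x0 | rewrite -[RHS]y0];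
  by congr (v 0 _); apply: val_inj.
Qed.

(** Quadratic formula: [T] is the trace of the combination, and the value required of [s ^+ 2] is
    its discriminant, trace squared minus four times the determinant. *)
Lemma char_poly_convex_comb (R : realType) (A B : 'M[R[i]]_2)
    (l1 l2 m1 m2 v1 v2 : R[i]) (a1 a2 : 'cV[R[i]]_2) (t : R) (s : R[i]) :
  l1 != l2 -> v1 != v2 ->
  is_eigenvector A l1 a1 -> is_eigenvector A l2 a2 ->
  is_eigenvector B m1 (v1 *: a1 + a2) -> is_eigenvector B m2 (v2 *: a1 + a2) ->
  s ^+ 2 = (1 - t%:C) ^+ 2 * (l1 - l2) ^+ 2
    + 2 * t%:C * (1 - t%:C) * (l1 - l2) * (m1 - m2) * ((v1 + v2) / (v1 - v2))
    + t%:C ^+ 2 * (m1 - m2) ^+ 2 ->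
  let T := (1 - t%:C) * (l1 + l2) + t%:C * (m1 + m2) in
  char_poly (convex_comb A B t) = ('X - ((T + s) / 2)%:P) * ('X - ((T - s) / 2)%:P).
Proof.
move=> l12 v12 [a10 A1] [a20 A2] [_ B1] [_ B2] sE T.
have d0 : v1 - v2 != 0 by rewrite subr_eq0.
pose w := (v1 - v2)^-1.
rewrite !mulmxDr -!scalemxAr in B1 B2.
(* The two eigenvectors of [B] differ by [(v1 - v2) *: a1]. *)
have Ba1 : B *m a1 = (w * (m1 * v1 - m2 * v2)) *: a1 + (w * (m1 - m2)) *: a2.
  apply/(scalerI d0); rewrite [LHS]scalerBl.
  have -> : v1 *: (B *m a1) - v2 *: (B *m a1)
      = m1 *: (v1 *: a1 + a2) - m2 *: (v2 *: a1 + a2).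
    by rewrite -B1 -B2 opprD addrACA subrr addr0.
  by apply/matrixP => i j; rewrite !mxE /w; field.
have Ba2 :
    B *m a2 = (w * (m2 - m1) * v1 * v2) *: a1 + (w * (m2 * v1 - m1 * v2)) *: a2.
  have -> : B *m a2 = m1 *: (v1 *: a1 + a2) - v1 *: (B *m a1).
    by rewrite -B1 addrC addKr.
  by rewrite Ba1; apply/matrixP => i j; rewrite !mxE /w; field.
pose u := t%:C : R[i].
apply: (@char_poly_basis2 _ _ a1 a2 ((1 - u) * l1 + u * (w * (m1 * v1 - m2 * v2)))
  (u * (w * (m2 - m1) * v1 * v2)) (u * (w * (m1 - m2)))
  ((1 - u) * l2 + u * (w * (m2 * v1 - m1 * v2)))).
- exact: eigenvectors_det2 A1 A2.
- rewrite /convex_comb mulmxDl -!scalemxAl A1 Ba1 rmorphB rmorph1 -/u.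
  by rewrite !scalerDr !scalerA addrA -scalerDl.
- rewrite /convex_comb mulmxDl -!scalemxAl A2 Ba2 rmorphB rmorph1 -/u.
  by rewrite !scalerDr !scalerA addrCA -scalerDl !mulrA.
- by rewrite /T -/u /w; field.
- have -> : (T + s) / 2 * ((T - s) / 2) = (T ^+ 2 - s ^+ 2) / 4 by field.
  by rewrite sE /T -/u /w; field.
Qed.

(** * Polar form, and arguments of negative multiples and inverses *)

Definition cis (R : realType) (t : R) : R[i] := cos t +i* sin t.

Lemma cisD (R : realType) (x y : R) : cis (x + y) = cis x * cis y.
Proof. by rewrite /cis cosD sinD /GRing.mul /= [X in _ +i* X]addrC. Qed.

Lemma cis0 (R : realType) : cis 0 = 1 :> R[i].
Proof. by rewrite /cis cos0 sin0. Qed.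

Lemma norm_cis (R : realType) (t : R) : `|cis t| = 1.
Proof. by rewrite normc_def /= cos2Dsin2 sqrtr1. Qed.

Lemma cis_neq0 (R : realType) (t : R) : cis t != 0.
Proof. by rewrite -normr_eq0 norm_cis oner_eq0. Qed.

Lemma cisN (R : realType) (t : R) : cis (- t) = (cis t)^-1.
Proof.
by apply: (mulfI (cis_neq0 t)); rewrite -cisD subrr cis0 divff // cis_neq0.
Qed.

Lemma cispi (R : realType) : cis pi = -1 :> R[i].
Proof. by apply/eqP; rewrite eq_complex /= cospi sinpi oppr0 !eqxx. Qed.

Lemma Arg_polar (R : realType) (r t : R) :
  0 < r -> - pi < t <= pi -> Arg (r%:C * cis t) = t.
Proof.
move=> r0 tI; have rC : r%:C != 0 :> R[i] by rewrite (inj_eq (@complexI _)) gt_eqF.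
apply: Arg_unique => //; first by rewrite mulf_neq0 ?cis_neq0.
by rewrite normrM norm_cis mulr1 ger0_norm // lecR ltW.
Qed.

Lemma polar (R : realType) (z : R[i]) : z != 0 ->
  exists2 r : R, 0 < r & z = r%:C * cis (Arg z).
Proof.
move=> z0; have [_ zE] := ArgP z0; exists (Re `|z|); last first.
  by rewrite [LHS]zE normc_def.
by rewrite -ltcR RRe_real ?normr_real // normr_gt0.
Qed.

(** A negative factor rotates by pi, in the direction that stays inside ]-pi, pi]. *)
Lemma Arg_scale_neg (R : realType) (k : R) (z : R[i]) : k < 0 -> z != 0 ->
  Arg (k%:C * z) = if 0 < Arg z then Arg z - pi else Arg z + pi.
Proof.
move=> k0 z0; have [r r0 zE] := polar z0; have [/andP[zl zu] _] := ArgP z0.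
have rk : 0 < - k * r by rewrite mulr_gt0 // oppr_gt0.
rewrite {1}zE; case: ltP => t0.
  rewrite -[RHS](Arg_polar rk); last by lra.
  by rewrite cisD cisN cispi invrN1 rmorphM rmorphN /=; congr Arg; ring.
rewrite -[RHS](Arg_polar rk); last by lra.
by rewrite cisD cispi rmorphM rmorphN /=; congr Arg; ring.
Qed.

Lemma Arg_inv (R : realType) (z : R[i]) : z != 0 ->
  Arg z^-1 = if Arg z == pi then pi else - Arg z.
Proof.
move=> z0; have [r r0 zE] := polar z0; have [/andP[zl zu] _] := ArgP z0.
have r'0 : 0 < r^-1 by rewrite invr_gt0.
rewrite {1}zE invfM -fmorphV -cisN; case: eqP => [->|/eqP zpi].
  by rewrite cisN cispi invrN1 -cispi Arg_polar //; have := pi_gt0 R; lra.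
have {}zu : Arg z < pi by rewrite lt_neqAle zpi.
by rewrite Arg_polar //; lra.
Qed.

Lemma max_Arg_scale_neg (R : realType) (k : R) (z : R[i]) : k < 0 -> z != 0 ->
  Num.max (Arg (k%:C * z)) (Arg (k%:C * z^-1)) = pi - `|Arg z|.
Proof.
move=> k0 z0; rewrite !Arg_scale_neg ?invr_eq0 // Arg_inv //.
have [/andP[zl zu] _] := ArgP z0; have pi0 := pi_gt0 R.
have [->|/eqP zpi] := eqP.
  by rewrite pi0 subrr maxxx gtr0_norm // subrr.
have {}zu : Arg z < pi by rewrite lt_neqAle zpi.
rewrite oppr_gt0; case: (ltrgtP 0 (Arg z)) => t0.
- by rewrite gtr0_norm // (elimT max_idPr); lra.
- by rewrite ltr0_norm // (elimT max_idPl); lra.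
- by rewrite -t0 normr0 oppr0 maxxx add0r addr0.
Qed.

(* With [rho] and [c] of arguments phi and psi, [w1] and [w2] have arguments
   (phi + psi) / 2 and (phi - psi) / 2. *)
Lemma sqrt_mul_div (R : realType) (rho c : R[i]) : rho != 0 -> c != 0 ->
  exists w1 w2 : R[i], [/\ w1 ^+ 2 = rho * c, w2 ^+ 2 = rho / c, w1 * w2 = rho &
    exists2 k, 0 < k & Re w1 * Re w2 = k * (cos (Arg rho) + cos (Arg c))].
Proof.
move=> rho0 c0; have [r r0 rE] := polar rho0; have [k k0 cE] := polar c0.
set phi := Arg rho in rE *; set psi := Arg c in cE *.
have sq (x : R) : 0 < x -> (Num.sqrt x)%:C * (Num.sqrt x)%:C = x%:C :> R[i].
  by move=> x0; rewrite -rmorphM -expr2 sqr_sqrtr // ltW.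
have half (x : R) : cis (x / 2) * cis (x / 2) = cis x.
  by rewrite -cisD -splitr.
pose u := (Num.sqrt r)%:C * cis (phi / 2); pose d := (Num.sqrt k)%:C * cis (psi / 2).
have uE : u ^+ 2 = rho by rewrite expr2 mulrACA sq // half -rE.
have dE : d ^+ 2 = c by rewrite expr2 mulrACA sq // half -cE.
have d0 : d != 0 by apply: contraNneq c0 => d0; rewrite -dE d0 expr0n.
exists (u * d), (u / d); split.
- by rewrite exprMn uE dE.
- by rewrite exprMn exprVn uE dE.
- by rewrite mulrACA divff // mulr1 -expr2 uE.
(* The moduli of [u * d] and [u / d] multiply to [r], and the product of two cosines is half the sum
   of the cosines of the sum and the difference of the angles. *)
exists (r / 2); first by rewrite divr_gt0.
have -> : u * d = (Num.sqrt r * Num.sqrt k)%:C * cis (phi / 2 + psi / 2).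
  by rewrite cisD rmorphM mulrACA.
have -> : u / d = (Num.sqrt r / Num.sqrt k)%:C * cis (phi / 2 - psi / 2).
  by rewrite cisD cisN rmorphM fmorphV /d invfM mulrACA.
rewrite /= !mul0r !subr0.
have k'0 : Num.sqrt k != 0 by rewrite gt_eqF // sqrtr_gt0.
rewrite mulrACA.
have -> : Num.sqrt r * Num.sqrt k * (Num.sqrt r / Num.sqrt k) = r.
  by rewrite -[RHS]sqr_sqrtr ?ltW //; field.
have -> : cos phi = cos ((phi / 2 + psi / 2) + (phi / 2 - psi / 2)).
  by congr cos; field.
have -> : cos psi = cos ((phi / 2 + psi / 2) - (phi / 2 - psi / 2)).
  by congr cos; field.
by move: (phi / 2 + psi / 2) (phi / 2 - psi / 2) => x y; rewrite cosD cosB; field.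
Qed.

(** * A continuous square root of the discriminant, and the pairing it induces *)

Lemma two_segments_sqrt_path (R : realType) (w1 w2 : R[i]) : 0 <= Re w1 * Re w2 ->
  exists g : R -> R[i]^o, [/\ continuous g, g 0 = 1, g 1 = w1 * w2,
    forall t, 0 <= t -> g t ^+ 2 =
      ((1 - t)%:C + t%:C * w1 ^+ 2) * ((1 - t)%:C + t%:C * w2 ^+ 2) &
    0 < Re w1 * Re w2 -> forall t, 0 <= t <= 1 -> g t != 0].
Proof.
(* The real parts are both nonnegative or both nonpositive, and negating both [w1] and [w2]
   preserves their squares and their product. *)
wlog : w1 w2 / 0 <= Re w1 /\ 0 <= Re w2.
  move=> H w12; have N (w : R[i]) : Re (- w) = - Re w by case: w.
  have [[a b]|[a b]] : (0 <= Re w1 /\ 0 <= Re w2) \/ (Re w1 <= 0 /\ Re w2 <= 0).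
  - have [a|a] := leP 0 (Re w1); have [b|b] := leP 0 (Re w2); [by left| | |].
    + by right; split; [rewrite -(nmulr_lge0 _ b) | exact: ltW].
    + by right; split; [exact: ltW | rewrite -(nmulr_rge0 _ a)].
    + by right; split; exact: ltW.
  - exact: H.
  have /H : 0 <= Re (- w1) /\ 0 <= Re (- w2) by rewrite !N !oppr_ge0.
  by rewrite !N !mulrNN !sqrrN; apply.
move=> [p1 p2] _.
have [g1 [c1 g10 g11 g1E g1n]] := segment_sqrt_path p1.
have [g2 [c2 g20 g21 g2E g2n]] := segment_sqrt_path p2.
exists (fun t => g1 t * g2 t); split.
- by move=> t; apply: cvgM; [exact: c1 | exact: c2].
- by rewrite g10 g20 mulr1.
- by rewrite g11 g21.
- by move=> t t0; rewrite exprMn g1E // g2E.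
- move=> w12 t tI; apply: mulf_neq0; [apply: g1n|apply: g2n] => //; nra.
Qed.

(* [g] is a continuous square root of the discriminant of the pencil, divided
   by [l1 - l2]. *)
Lemma convex_eigenpairing_of_sqrt (R : realType) (A B : 'M[R[i]]_2)
    (l1 l2 m1 m2 v1 v2 : R[i]) (a1 a2 : 'cV[R[i]]_2) (f : R[i] -> R[i])
    (g : R -> R[i]^o) :
  l1 != l2 -> v1 != v2 ->
  is_eigenvector A l1 a1 -> is_eigenvector A l2 a2 ->
  is_eigenvector B m1 (v1 *: a1 + a2) -> is_eigenvector B m2 (v2 *: a1 + a2) ->
  continuous g -> g 0 = 1 ->
  (forall t, 0 <= t <= 1 -> ((l1 - l2) * g t) ^+ 2 =
    (1 - t%:C) ^+ 2 * (l1 - l2) ^+ 2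
    + 2 * t%:C * (1 - t%:C) * (l1 - l2) * (m1 - m2) * ((v1 + v2) / (v1 - v2))
    + t%:C ^+ 2 * (m1 - m2) ^+ 2) ->
  f l1 != f l2 -> f l1 + f l2 = m1 + m2 -> f l1 - f l2 = (l1 - l2) * g 1 ->
  convex_eigenpairing A B f /\
  ((forall t, 0 <= t <= 1 -> g t != 0) -> only_convex_eigenpairing A B f).
Proof.
move=> l12 v12 A1 A2 B1 B2 gc g0 gE fl fD fB.
have l0 : l1 - l2 != 0 by rewrite subr_eq0.
(* [T t] is the trace of the combination at [t]; [e1] and [e2] are its eigenvalues by the quadratic
   formula. *)
pose T (t : R) : R[i]^o := (1 - t%:C) * (l1 + l2) + t%:C * (m1 + m2).
pose e1 (t : R) : R[i]^o := (T t + (l1 - l2) * g t) / 2.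
pose e2 (t : R) : R[i]^o := (T t - (l1 - l2) * g t) / 2.
have tc : continuous (fun t : R => t%:C : R[i]^o).
  apply: (@continuous_complex _ (fun x => x) (fun=> 0)) => x.
    exact: cvg_id.
  exact: cvg_cst.
have uc : continuous (fun t : R => 1 - t%:C : R[i]^o).
  by move=> t; apply: cvgD; [exact: cvg_cst | apply: cvgN; exact: tc].
have Tc : continuous T.
  move=> t; apply: cvgD; apply: cvgM; try exact: cvg_cst; last exact: tc.
  exact: uc.
have lgc : continuous (fun t => (l1 - l2) * g t : R[i]^o).
  by move=> t; apply: cvgM; [exact: cvg_cst | exact: gc].
have e1c : continuous e1.
  move=> t; apply: cvgM; last exact: cvg_cst.
  by apply: cvgD; [exact: Tc | exact: lgc].
have e2c : continuous e2.
  move=> t; apply: cvgM; last exact: cvg_cst.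
  by apply: cvgB; [exact: Tc | exact: lgc].
have charE t : 0 <= t <= 1 -> char_poly (convex_comb A B t) =
    ('X - (e1 t : R[i])%:P) * ('X - (e2 t : R[i])%:P).
  by move=> tI; exact: (char_poly_convex_comb l12 v12 A1 A2 B1 B2 (gE t tI)).
have e10 : e1 0 = l1 by rewrite /e1 /T g0 rmorph0; field.
have e20 : e2 0 = l2 by rewrite /e2 /T g0 rmorph0; field.
have e11 : e1 1 = f l1 by rewrite /e1 /T -fB -fD rmorph1; field.
have e21 : e2 1 = f l2 by rewrite /e2 /T -fB -fD rmorph1; field.
have [e0 e1'] : e1 0 != e2 0 /\ e1 1 != e2 1 by rewrite e10 e20 e11 e21.
have [f1 f2] : f (e1 0) = e1 1 /\ f (e2 0) = e2 1 by rewrite e10 e20 e11 e21.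
split; first exact: (convex_eigenpairing_of_paths e1c e2c).
move=> gn; apply: (only_convex_eigenpairing_of_paths e1c e2c) => // t tI.
rewrite -subr_eq0.
have -> : e1 t - e2 t = (l1 - l2) * g t by rewrite /e1 /e2; field.
by rewrite mulf_neq0 ?gn.
Qed.

(** * Comparison of the argument of mu / lambda with the threshold *)

Theorem theorem4 (R : realType) (A B : 'M[R[i]]_2)
    (lambda1 lambda2 mu1 mu2 v1 v2 s : R[i]) (a1 a2 : 'cV[R[i]]_2)
    (p q : R[i] -> R[i])
    (hlambda : lambda1 != lambda2) (hmu : mu1 != mu2)
    (hA1 : is_eigenvector A lambda1 a1)
    (hA2 : is_eigenvector A lambda2 a2)
    (hB1 : is_eigenvector B mu1 (v1 *: a1 + a2))
    (hB2 : is_eigenvector B mu2 (v2 *: a1 + a2))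
    (hp1 : p lambda1 = mu1) (hp2 : p lambda2 = mu2)
    (hq1 : q lambda1 = mu2) (hq2 : q lambda2 = mu1)
    (hs : s ^+ 2 = v1 * v2) :
  let lambda := lambda1 - lambda2 in
  let mu := mu1 - mu2 in
  [/\ v1 != v2,
      forall alpha : R, 0 < alpha < 1 ->
        threshold_number v1 v2 s alpha != 0 /\
        threshold_number v1 v2 (- s) alpha != 0,
      forall alpha beta : R, 0 < alpha < 1 -> 0 < beta < 1 ->
        Arg (threshold_number v1 v2 s alpha) =
          Arg (threshold_number v1 v2 s beta) /\
        Arg (threshold_number v1 v2 (- s) alpha) =
          Arg (threshold_number v1 v2 (- s) beta) &
      forall alpha : R, 0 < alpha < 1 ->
        let theta := threshold v1 v2 s alpha in
        [/\ `|Arg (mu / lambda)| = theta ->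
              convex_eigenpairing A B p /\ convex_eigenpairing A B q,
            `|Arg (mu / lambda)| < theta -> only_convex_eigenpairing A B p &
            `|Arg (mu / lambda)| > theta -> only_convex_eigenpairing A B q]].
Proof.
move=> lambda mu.
have lambda0 : lambda != 0 by rewrite subr_eq0.
have mu0 : mu != 0 by rewrite subr_eq0.
(* Otherwise one eigenvector of [B] would have two distinct eigenvalues. *)
have v12 : v1 != v2.
  apply/eqP => v12; have [x0 E1] := hB1; have [_ E2] := hB2.
  move: E2; rewrite -v12 E1 => /eqP; rewrite -subr_eq0 -scalerBl scaler_eq0.
  by rewrite (negPf x0) orbF subr_eq0 (negPf hmu).
have d0 : v1 - v2 != 0 by rewrite subr_eq0.
pose c := (v1 + v2 + 2 * s) / (v1 - v2).
pose c' := (v1 + v2 + 2 * - s) / (v1 - v2).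
(* The numerators multiply to [(v1 + v2) ^+ 2 - 4 * (v1 * v2) = (v1 - v2) ^+ 2]. *)
have cc' : c * c' = 1.
  have -> : c * c' = ((v1 + v2) ^+ 2 - 4 * s ^+ 2) / (v1 - v2) ^+ 2.
    by rewrite /c /c'; field.
  by rewrite hs; field.
have c0 : c != 0.
  by apply/eqP => z; move: cc'; rewrite z mul0r => /eqP; rewrite eq_sym oner_eq0.
have c'E : c' = c^-1 by apply: (mulfI c0); rewrite cc' divff.
(* The real factor is negative for every [t], so the arguments depend on [c] alone. *)
have neg (t : R) : 0 < t < 1 -> (t - 1) / t < 0.
  by move=> /andP[t0 t1]; rewrite pmulr_llt0 ?invr_gt0 // subr_lt0.
have numE t : threshold_number v1 v2 s t = ((t - 1) / t)%:C * c by [].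
have numE' t : threshold_number v1 v2 (- s) t = ((t - 1) / t)%:C * c^-1.
  by rewrite -c'E.
have cV0 : c^-1 != 0 by rewrite invr_eq0.
split=> // [t tI|t u tI uI|t tI theta].
- have nz : ((t - 1) / t)%:C != 0 :> R[i].
    by rewrite (inj_eq (@complexI R)) lt_eqF ?neg.
  by rewrite numE numE'; split; apply: mulf_neq0.
- by rewrite !numE !numE' !Arg_scale_neg ?neg.
have rho0 : mu / lambda != 0 by rewrite mulf_neq0 ?invr_eq0.
have -> : theta = pi - `|Arg c|.
  by rewrite /theta /threshold numE numE' max_Arg_scale_neg ?neg.
have [w1 [w2 [w1E w2E w12 [k k0 ReE]]]] := sqrt_mul_div rho0 c0.
set phi := Arg (mu / lambda) in ReE *.
have [phi_ge phi_le] : 0 <= `|phi| /\ `|phi| <= pi.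
  have [/andP[? ?] _] := ArgP rho0; rewrite normr_ge0 ler_norml; split=> //.
  by apply/andP; split; rewrite /phi; lra.
have [psi_ge psi_le] : 0 <= pi - `|Arg c| /\ pi - `|Arg c| <= pi.
  have [/andP[? ?] _] := ArgP c0.
  by rewrite gerBl normr_ge0 subr_ge0 ler_norml; split=> //; lra.
have {}ReE : Re w1 * Re w2 = k * (cos `|phi| - cos (pi - `|Arg c|)).
  by rewrite ReE cosB cospi sinpi mul0r addr0 mulN1r opprK !cos_norm.
(* The cosine is strictly decreasing on [0, pi], where both angles lie. *)
have cosE : (0 < cos `|phi| - cos (pi - `|Arg c|)) = (`|phi| < pi - `|Arg c|).
  by rewrite subr_gt0 ltr_cos ?in_itv /= ?phi_ge ?psi_ge.
have cosE' : (cos `|phi| - cos (pi - `|Arg c|) < 0) = (pi - `|Arg c| < `|phi|).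
  by rewrite subr_lt0 ltr_cos ?in_itv /= ?phi_ge ?psi_ge.
have disc (x : R) : lambda ^+ 2 * (((1 - x)%:C + x%:C * w1 ^+ 2) *
      ((1 - x)%:C + x%:C * w2 ^+ 2)) = (1 - x%:C) ^+ 2 * lambda ^+ 2
      + 2 * x%:C * (1 - x%:C) * lambda * mu * ((v1 + v2) / (v1 - v2))
      + x%:C ^+ 2 * mu ^+ 2.
  have -> : (v1 + v2) / (v1 - v2) = (c + c^-1) / 2.
    by rewrite -c'E /c /c'; field.
  by rewrite w1E w2E rmorphB rmorph1; field; rewrite c0.
(* To be used with [w2' = w2] for [p] and [w2' = - w2] for [q]: the sign decides whether the square
   root ends at rho or at its opposite. *)
have pairing f (w2' : R[i]) : w2' ^+ 2 = w2 ^+ 2 -> 0 <= Re w1 * Re w2' ->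
    f lambda1 != f lambda2 -> f lambda1 + f lambda2 = mu1 + mu2 ->
    f lambda1 - f lambda2 = lambda * (w1 * w2') ->
    convex_eigenpairing A B f /\
    (0 < Re w1 * Re w2' -> only_convex_eigenpairing A B f).
  move=> sq2 pos fl fD fB.
  have [g [gc g0 g1 gE gn]] := two_segments_sqrt_path pos.
  have [|//|f1 f2] :=
    convex_eigenpairing_of_sqrt hlambda v12 hA1 hA2 hB1 hB2 gc g0 _ fl fD.
  - by move=> x /andP[x0 _]; rewrite exprMn gE // sq2 disc.
  - by rewrite g1.
  - by split=> // pos'; apply/f2/gn.
have pP : 0 <= Re w1 * Re w2 -> convex_eigenpairing A B p /\
    (0 < Re w1 * Re w2 -> only_convex_eigenpairing A B p).
  move=> pos; apply: pairing => //; rewrite ?hp1 ?hp2 //.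
  by rewrite w12 mulrC divfK.
have qP : Re w1 * Re w2 <= 0 -> convex_eigenpairing A B q /\
    (Re w1 * Re w2 < 0 -> only_convex_eigenpairing A B q).
  move=> npos; have NE : Re w1 * Re (- w2) = - (Re w1 * Re w2).
    by case: (w2) => x y /=; rewrite mulrN.
  have := pairing q (- w2); rewrite sqrrN NE oppr_ge0 oppr_gt0; apply => //.
  - by rewrite hq1 hq2 eq_sym.
  - by rewrite hq1 hq2 addrC.
  - by rewrite hq1 hq2 !mulrN w12 [lambda * _]mulrC divfK // opprB.
split=> h.
(* On the boundary the product of real parts vanishes, so both signs of [w2] are admissible. *)
- have z : Re w1 * Re w2 = 0 by rewrite ReE h subrr mulr0.
  by split; [apply: (pP _).1 | apply: (qP _).1]; rewrite z.
- have pos : 0 < Re w1 * Re w2 by rewrite ReE pmulr_rgt0 // cosE.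
  by apply: (pP (ltW pos)).2.
- have npos : Re w1 * Re w2 < 0 by rewrite ReE pmulr_rlt0 // cosE'.
  by apply: (qP (ltW npos)).2.
Qed.
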